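(* Let the system $x_{t+1}=f(x_t,u_t)$, $y_t=h(x_t)$ admit a Koopman linear embedding, and assume that the system is stabilizable and detectable (in the sense given in the context). Then there exists an observable and stabilizable Koopman linear embedding realization of the system, i.e. a Koopman linear embedding with matrices $(A,B,C)$ such that the pair $(A,C)$ is observable and the pair $(A,B)$ is stabilizable.
   Context: **System.** $x_t\in\mathbb{R}^n$, $u_t\in\mathbb{R}^m$, $y_t\in\mathbb{R}^p$ are the state, input and output at time $t$; $f:\mathbb{R}^n\times\mathbb{R}^m\to\mathbb{R}^n$ and $h:\mathbb{R}^n\to\mathbb{R}^p$ are continuous with $f(0,0)=0$, $h(0)=0$. **Stabilizable and detectable (nonlinear system).** Stabilizable: for every initial condition $x_0\in\mathbb{R}^n$ there exists a control sequence $\{u_t\}_{t=0}^\infty$ such that $x_t\to0$ as $t\to\infty$. Detectable: $y_t\to0$ as $t\to\infty$ implies $x_t\to0$ as well. **Koopman linear embedding (KLE).** The system is said to admit a KLE if there exist a scalar $\eta\in\mathbb{N}$, matrices $(A,B,C)$ of appropriate dimensions, and a set of linearly independent functions $\psi_i:\mathbb{R}^n\to\mathbb{R}$, $i=1,\dots,\eta$, such that $\Psi(x_{t+1})=A\Psi(x_t)+Bu_t$ and $y_t=C\Psi(x_t)$ hold for all $t$ (along the trajectories of the system), where $\Psi(x_t)=[\psi_1(x_t)\ \cdots\ \psi_\eta(x_t)]^\top$. The associated linear system $\xi_{t+1}=A\xi_t+Bu_t$, $y_t=C\xi_t$, with $\xi_t\in\mathbb{R}^\eta$, is also referred to as a KLE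 (realization) of the nonlinear system; observability and stabilizability of a realization are the usual notions for this linear system, with arbitrary initial state $\xi_0\in\mathbb{R}^\eta$. *)

(* Defs.v *)
(* R^k is 'cV[R]_k, with its sup-distance topology. *)
From HB Require Import structures.
From mathcomp Require Import all_boot all_order all_algebra.
From mathcomp Require Import all_classical all_reals all_analysis.
Set Implicit Arguments.
Unset Strict Implicit.
Unset Printing Implicit Defensive.
Import Order.TTheory GRing.Theory Num.Theory.
Import numFieldNormedType.Exports.

Local Open Scope classical_set_scope.
Local Open Scope ring_scope.

Section Systems.
Context {R : realType} {n m p : nat}.
Implicit Types (f : 'cV[R]_n -> 'cV[R]_m -> 'cV[R]_n) (h : 'cV[R]_n -> 'cV[R]_p).

Definition trajectory f (x : nat -> 'cV[R]_n) (u : nat -> 'cV[R]_m) : Prop :=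
  forall t, x t.+1 = f (x t) (u t).

Definition stabilizable f : Prop :=
  forall x0 : 'cV[R]_n, exists u x,
    [/\ trajectory f x u, x 0%N = x0 & x t @[t --> \oo] --> (0 : 'cV[R]_n)].

(* The implication ranges over all trajectories, hence over all initial states
   and all input sequences. *)
Definition detectable f h : Prop :=
  forall x u, trajectory f x u ->
    h (x t) @[t --> \oo] --> (0 : 'cV[R]_p) ->
    x t @[t --> \oo] --> (0 : 'cV[R]_n).

(* The inputs and outputs over some finite horizon determine the initial
   state. *)
Definition observable f h : Prop :=
  exists T : nat, forall u x x',
    trajectory f x u -> trajectory f x' u ->
    (forall t, (t < T)%N -> h (x t) = h (x' t)) ->
    x 0%N = x' 0%N.

End Systems.

Section Koopman.
Context {R : realType} {n m p : nat}.

Definition lin_dyn (eta : nat) (A : 'M[R]_eta) (B : 'M[R]_(eta, m))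
  (xi : 'cV[R]_eta) (u : 'cV[R]_m) : 'cV[R]_eta := A *m xi + B *m u.

Definition lin_out (eta : nat) (C : 'M[R]_(p, eta)) (xi : 'cV[R]_eta) :
  'cV[R]_p := C *m xi.

Definition lin_indep (T : Type) (eta : nat) (psi : 'I_eta -> T -> R) : Prop :=
  forall c : 'I_eta -> R,
    (forall x, \sum_(i < eta) c i * psi i x = 0) -> forall i, c i = 0.

Definition lift_map (eta : nat) (psi : 'I_eta -> 'cV[R]_n -> R)
  (x : 'cV[R]_n) : 'cV[R]_eta := \col_(i < eta) psi i x.

(* The lifting functions need not be continuous, and eta = 0 is allowed: for
   h = 0 the only observable embedding is the one with no lifting function. *)
Definition is_KLE (f : 'cV[R]_n -> 'cV[R]_m -> 'cV[R]_n)
  (h : 'cV[R]_n -> 'cV[R]_p) (eta : nat) (A : 'M[R]_eta)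
  (B : 'M[R]_(eta, m)) (C : 'M[R]_(p, eta))
  (psi : 'I_eta -> 'cV[R]_n -> R) : Prop :=
  lin_indep psi /\
  forall x u, trajectory f x u -> forall t,
    lift_map psi (x t.+1) = A *m lift_map psi (x t) + B *m u t /\
    h (x t) = C *m lift_map psi (x t).

Definition admits_KLE (f : 'cV[R]_n -> 'cV[R]_m -> 'cV[R]_n)
  (h : 'cV[R]_n -> 'cV[R]_p) : Prop :=
  exists (eta : nat) (A : 'M[R]_eta) (B : 'M[R]_(eta, m))
    (C : 'M[R]_(p, eta)) (psi : 'I_eta -> 'cV[R]_n -> R), is_KLE f h A B C psi.

End Koopman.

(* Main.v *)
(* The outputs produced by the zero input are C Psi, C A Psi, C A^2 Psi, ...;
   since f and h are continuous and fix the origin, all of them tend to 0 as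
   x -> 0, although Psi itself need not be continuous.  Quotienting the
   embedding by its unobservable subspace leaves only linear combinations of
   these functions, so in the observable quotient the lifted state tends to 0
   along every trajectory with x_t -> 0.  Hence all lifted states can be steered
   to 0; by linear independence they span the lifted space, and the set of
   linear states that can be steered to 0 is a subspace. *)
Require Import Defs.
From HB Require Import structures.
From mathcomp Require Import all_boot all_order all_algebra.
From mathcomp Require Import all_classical all_reals all_analysis.
Set Implicit Arguments.
Unset Strict Implicit.
Unset Printing Implicit Defensive.
Import Order.TTheory GRing.Theory Num.Theory.
Import numFieldNormedType.Exports.
Local Open Scope classical_set_scope.
Local Open Scope ring_scope.

(** * Limits of matrix-valued functions, taken entrywise *)

Lemma cvg_mx (K : numFieldType) (T : Type) (F : set_system T)
    {FF : Filter F} (a b : nat)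
    (g : T -> 'M[K]_(a, b)) (l : 'M[K]_(a, b)) :
  (forall i j, g x i j @[x --> F] --> l i j) -> g x @[x --> F] --> l.
Proof.
move=> gl; apply/cvg_ballP => e e0.
rewrite near_simpl.
have : \forall x \near F, forall ij : 'I_a * 'I_b,
    ball (l ij.1 ij.2) e (g x ij.1 ij.2).
  by apply: filter_forall => -[i j] /=; move/cvg_ballP: (gl i j); apply.
by apply: filterS => x gx; split=> // i j; exact: (gx (i, j)).
Qed.

Lemma cvg_coord (K : numFieldType) (T : Type) (F : set_system T)
    {FF : Filter F} (a b : nat)
    (g : T -> 'M[K]_(a, b)) (l : 'M[K]_(a, b)) i j :
  g x @[x --> F] --> l -> g x i j @[x --> F] --> l i j.
Proof.
move=> gl; apply: (cvg_comp g (fun M : 'M[K]_(a, b) => M i j) gl).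
exact: coord_continuous.
Qed.

Lemma cvg_mulmxr (K : numFieldType) (T : Type) (F : set_system T)
    {FF : Filter F} (a b c : nat) (M : 'M[K]_(a, b)) (g : T -> 'M[K]_(b, c))
    (l : 'M[K]_(b, c)) :
  g x @[x --> F] --> l -> M *m g x @[x --> F] --> M *m l.
Proof.
move=> gl; apply: cvg_mx => i j; rewrite mxE.
under eq_fun do rewrite mxE.
apply: cvg_big => [|k _]; first exact: add_continuous.
by apply: cvgMl_tmp; exact: cvg_coord.
Qed.

Lemma cvg_addmx (K : numFieldType) (T : Type) (F : set_system T)
    {FF : Filter F} (a b : nat) (g1 g2 : T -> 'M[K]_(a, b))
    (l1 l2 : 'M[K]_(a, b)) :
  g1 x @[x --> F] --> l1 -> g2 x @[x --> F] --> l2 ->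
  g1 x + g2 x @[x --> F] --> l1 + l2.
Proof.
move=> g1l g2l; apply: cvg_mx => i j; rewrite mxE.
by under eq_fun do rewrite mxE; apply: cvgD; exact: cvg_coord.
Qed.

Lemma cvg_scalemx (K : numFieldType) (T : Type) (F : set_system T)
    {FF : Filter F} (a b : nat) (k : K) (g : T -> 'M[K]_(a, b))
    (l : 'M[K]_(a, b)) :
  g x @[x --> F] --> l -> k *: g x @[x --> F] --> k *: l.
Proof.
move=> gl; apply: cvg_mx => i j; rewrite mxE.
by under eq_fun do rewrite mxE; apply: cvgMl_tmp; exact: cvg_coord.
Qed.

Lemma trajectory_exists (R : realType) (n m : nat)
    (f : 'cV[R]_n -> 'cV[R]_m -> 'cV[R]_n) x0 u :
  exists2 x, trajectory f x u & x 0%N = x0.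
Proof.
by exists (fix x t := if t is s.+1 then f (x s) (u s) else x0).
Qed.

(** * Linear algebra of observability and spanning *)

(* [obs A C k] spans the row space of the observability matrix
   [C; C A; ...; C A^(k-1)]. *)
Fixpoint obs (F : fieldType) (p eta : nat) (A : 'M[F]_eta) (C : 'M[F]_(p, eta))
    (k : nat) : 'M[F]_eta :=
  if k is k'.+1 then (C + obs A C k' *m A)%MS else 0.

Section Observability.
Variables (F : fieldType) (p eta : nat) (A : 'M[F]_eta) (C : 'M[F]_(p, eta)).
Local Notation obs := (obs A C).

Lemma obsS k : (obs k <= obs k.+1)%MS.
Proof.
elim: k => [|k IHk] /=; first exact: sub0mx.
exact: addsmxS (submx_refl _) (submxMr _ IHk).
Qed.

(* The ranks of the increasing sequence [obs k] are bounded, so it is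
   stationary. *)
Lemma obs_stable :
  exists k, (C <= obs k)%MS /\ (obs k *m A <= obs k)%MS.
Proof.
have exr : exists r, `[< exists k, \rank (obs k) = r >].
  by exists (\rank (obs 0)); apply/asboolP; exists 0%N.
have ubr r : `[< exists k, \rank (obs k) = r >] -> (r <= eta)%N.
  by move=> /asboolP[k <-]; exact: rank_leq_row.
have [_ /asboolP[k <-] kmax] := ex_maxnP exr ubr.
have kS : (obs k.+1 <= obs k)%MS.
  rewrite -(geq_leqif (mxrank_leqif_sup (obsS k))).
  by apply: kmax; apply/asboolP; exists k.+1.
exists k; split; apply: submx_trans kS.
  exact: addsmxSl.
exact: addsmxSr.
Qed.

(** Since [d t] is [A^t *m d 0], the products [C *m d t] with [t < k] are the blocks of the
    observability matrix applied to [d 0]. The induction shifts [d] by one step, absorbing the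
    factor [A] into [d 1]. *)
Lemma obs_mul_eq0 k (d : nat -> 'cV[F]_eta) :
  (forall t, d t.+1 = A *m d t) -> (forall t, (t < k)%N -> C *m d t = 0) ->
  obs k *m d 0%N = 0.
Proof.
elim: k d => [|k IHk] d dS Cd; first by rewrite mul0mx.
have /sub_addsmxP[[u v] /= ->] : (obs k.+1 <= C + obs k *m A)%MS by [].
rewrite mulmxDl -!mulmxA Cd // -dS (IHk (fun t => d t.+1)) ?mulmx0 ?addr0 //.
by move=> t tk; exact: Cd.
Qed.

End Observability.

(** Coordinates on the quotient by the kernel of [V]: [T] is the projection and [P] a section of it.
    A matrix with rows in the row space of [V] vanishes on that kernel, hence factors through
    [T]. *)
Lemma rowspace_coordinates (F : fieldType) (q eta : nat) (V : 'M[F]_(q, eta)) :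
  exists (r : nat) (T : 'M[F]_(r, eta)) (P : 'M[F]_(eta, r)),
    [/\ T *m P = 1%:M, (T <= V)%MS &
        forall s (M : 'M[F]_(s, eta)), (M <= V)%MS -> M *m P *m T = M].
Proof.
exists _, (row_base V), (pinvmx (row_base V)); split.
- exact/mulmxVp/row_base_free.
- by rewrite eq_row_base.
- by move=> s M MV; apply: mulmxKpV; rewrite eq_row_base.
Qed.

(** A subspace of maximal rank inside [S] contains every [phi x], since adjoining [phi x] stays
    inside [S]. A functional vanishing on it then kills all of [phi], so it is zero and the subspace
    is everything. *)
Lemma lin_indep_span (F : fieldType) (T : Type) (eta : nat)
    (phi : T -> 'cV[F]_eta) (S : 'cV[F]_eta -> Prop) :
  (forall c : 'rV[F]_eta, (forall x, c *m phi x = 0) -> c = 0) ->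
  S 0 -> (forall a v w, S v -> S w -> S (a *: v + w)) ->
  (forall x, S (phi x)) -> forall v, S v.
Proof.
move=> phi_indep S0 SD Sphi.
(* Subspaces are row spaces here, hence the transposes. *)
pose good (V : 'M[F]_eta) := forall w : 'rV[F]_eta, (w <= V)%MS -> S w^T.
have exr : exists r, `[< exists2 V, good V & \rank V = r >].
  exists 0%N; apply/asboolP; exists 0; last by rewrite mxrank0.
  by move=> w /submx0null ->; rewrite trmx0.
have ubr r : `[< exists2 V, good V & \rank V = r >] -> (r <= eta)%N.
  by move=> /asboolP[V _ <-]; exact: rank_leq_row.
have [_ /asboolP[V goodV <-] Vmax] := ex_maxnP exr ubr.
have phiV x : ((phi x)^T <= V)%MS.
  apply: (@submx_trans _ _ _ _ _ _ (V + (phi x)^T)%MS); first exact: addsmxSr.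
  rewrite -(geq_leqif (mxrank_leqif_sup (addsmxSl V (phi x)^T))).
  apply: Vmax; apply/asboolP; exists (V + (phi x)^T)%MS => //.
  move=> w /sub_addsmxP[[u v] /= ->].
  rewrite addrC linearD /= [v]mx11_scalar mul_scalar_mx linearZ /= trmxK.
  by apply: SD => //; apply: goodV; exact: submxMl.
have cok0 : (cokermx V)^T = 0.
  apply/row_matrixP => i; rewrite row0; apply: phi_indep => x.
  rewrite -row_mul -[phi x]trmxK -trmx_mul.
  by have := phiV x; rewrite submxE => /eqP ->; rewrite trmx0 row0.
move=> v; rewrite -[v]trmxK; apply: goodV; rewrite submxE.
by rewrite -[cokermx V]trmxK cok0 trmx0 mulmx0.
Qed.

(** * Koopman embeddings: observable quotient and stabilizability *)

Section KoopmanEmbedding.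
Variables (R : realType) (n m p : nat).
Variables (f : 'cV[R]_n -> 'cV[R]_m -> 'cV[R]_n) (h : 'cV[R]_n -> 'cV[R]_p).

Lemma lin_indepP eta (psi : 'I_eta -> 'cV[R]_n -> R) :
  lin_indep psi <->
  forall c : 'rV[R]_eta, (forall x, c *m lift_map psi x = 0) -> c = 0.
Proof.
split=> [indep c c0 | indep c c0 i].
  apply/rowP => i; rewrite mxE; apply: (indep (c 0)) => x.
  have /matrixP/(_ 0 0) := c0 x; rewrite !mxE => {2}<-.
  by apply: eq_bigr => j _; rewrite mxE.
have /rowP/(_ i) : \row_j c j = 0; last by rewrite !mxE.
apply: indep => x; apply/matrixP => a b; rewrite !mxE -[RHS](c0 x).
by apply: eq_bigr => j _; rewrite !mxE.
Qed.

(** Every pair [(x, u)] starts a trajectory, here the one with constant input [u], so the identities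
    along trajectories hold pointwise. *)
Lemma KLE_step eta A B C (psi : 'I_eta -> 'cV[R]_n -> R) x u :
  is_KLE f h A B C psi ->
  lift_map psi (f x u) = A *m lift_map psi x + B *m u /\
  h x = C *m lift_map psi x.
Proof.
move=> [_ kle].
have [xs xs_traj xs0] := trajectory_exists f x (fun=> u).
by have := kle _ _ xs_traj 0%N; rewrite xs_traj xs0.
Qed.

Hypotheses (f_cont : continuous (fun z : 'cV[R]_n * 'cV[R]_m => f z.1 z.2))
  (h_cont : continuous h) (f00 : f 0 0 = 0) (h0 : h 0 = 0).

Lemma obs_lift_cvg0 eta A B C (psi : 'I_eta -> 'cV[R]_n -> R) k :
  is_KLE f h A B C psi ->
  obs A C k *m lift_map psi x @[x --> (0 : 'cV[R]_n)] --> (0 : 'cV[R]_eta).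
Proof.
move=> kle.
have cvg_f0 : f x 0 @[x --> (0 : 'cV[R]_n)] --> (0 : 'cV[R]_n).
  rewrite -[X in _ --> X]f00.
  apply: (@continuous2_cvg _ 'cV[R]_n 'cV[R]_m 'cV[R]_n
    (nbhs (0 : 'cV[R]_n)) _ id (fun=> 0) f 0 0 (@f_cont (0, 0))).
    exact: cvg_id.
  exact: cvg_cst.
elim: k => [|k IHk].
  by rewrite (funext (fun x => mul0mx _ (lift_map psi x))); apply: cvg_cst;
     exact: nbhs_filter.
have /sub_addsmxP[[u v] /= ->] : (obs A C k.+1 <= C + obs A C k *m A)%MS by [].
(* Trading [A] for one step of [f] under zero input leaves only [h] and the previous stage composed
   with [f x 0], both of which have limits at the origin. *)
have stepE x : (u *m C + v *m (obs A C k *m A)) *m lift_map psi x =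
    u *m h x + v *m (obs A C k *m lift_map psi (f x 0)).
  have [-> ->] := KLE_step x 0 kle.
  by rewrite mulmx0 addr0 mulmxDl !mulmxA.
rewrite (funext stepE).
have cvg_h0 : h x @[x --> (0 : 'cV[R]_n)] --> (0 : 'cV[R]_p).
  by rewrite -[X in _ --> X]h0; exact: h_cont.
have := cvg_addmx (cvg_mulmxr (M := u) cvg_h0)
  (cvg_mulmxr (M := v) (cvg_comp (fun x => f x 0) _ cvg_f0 IHk)).
by rewrite !mulmx0 addr0 => cvg_sum; exact: cvg_sum.
Qed.

Lemma observable_KLE : admits_KLE f h ->
  exists eta (A : 'M[R]_eta) (B : 'M[R]_(eta, m)) (C : 'M[R]_(p, eta))
    (psi : 'I_eta -> 'cV[R]_n -> R),
    [/\ is_KLE f h A B C psi, observable (lin_dyn A B) (lin_out C) &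
        lift_map psi x @[x --> (0 : 'cV[R]_n)] --> (0 : 'cV[R]_eta)].
Proof.
move=> [eta [A [B [C [psi kle]]]]].
have [k [C_sub A_sub]] := obs_stable A C.
have [r [T [P [TP T_sub PT]]]] := rowspace_coordinates (obs A C k).
(* The kernel of [obs A C k] is stable under [A] and killed by [C], so both descend to the
   quotient. *)
have TA : T *m A *m P *m T = T *m A.
  by apply: PT; apply: submx_trans A_sub; exact: submxMr.
have CT : C *m P *m T = C by exact: PT.
pose psi' i x := (T *m lift_map psi x) i 0.
have lift' x : lift_map psi' x = T *m lift_map psi x.
  by apply/colP => i; rewrite mxE.
exists r, (T *m A *m P), (T *m B), (C *m P), psi'; split.
- have [/lin_indepP indep kle_traj] := kle; split.
    (* [c *m T] annihilates the original lift, so it is zero, and [P] recovers [c] from it. *)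
    apply/lin_indepP => c c0; rewrite -[c]mulmx1 -TP mulmxA.
    by rewrite [c *m T]indep ?mul0mx // => x; rewrite -mulmxA -lift'.
  move=> x u xu t; rewrite !lift'; have [-> ->] := kle_traj x u xu t.
  by rewrite mulmxDr !mulmxA TA CT.
- exists k => u x x' xu xu' out_eq.
  (* The difference of the two trajectories lifts along [T] to a trajectory of
     the original linear system with zero input. *)
  have [e eS e0] := trajectory_exists (fun v (_ : 'cV[R]_m) => A *m v)
    (P *m (x 0%N - x' 0%N)) (fun=> 0).
  have Te t : T *m e t = x t - x' t.
    elim: t => [|t IHt]; first by rewrite e0 mulmxA TP mul1mx.
    rewrite eS mulmxA -TA -!mulmxA IHt xu xu' /lin_dyn.
    by rewrite opprD addrACA subrr addr0 -mulmxBr !mulmxA.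
  apply/eqP; rewrite -subr_eq0 -Te.
  (* The rows of [T] lie in those of [obs A C k], which kills [e 0] because the first [k] outputs of
     [e] vanish. *)
  have /submxP[D ->] := T_sub.
  rewrite -mulmxA (obs_mul_eq0 eS) ?mulmx0 // => t tk.
  by rewrite -CT -(mulmxA _ T) Te mulmxBr [X in X - _](out_eq _ tk) subrr.
- have /submxP[D TD] := T_sub.
  have liftD x : lift_map psi' x = D *m (obs A C k *m lift_map psi x).
    by rewrite lift' TD mulmxA.
  rewrite (funext liftD).
  have := cvg_mulmxr (M := D) (obs_lift_cvg0 k kle).
  by rewrite mulmx0 => cvg_D; exact: cvg_D.
Qed.

Lemma stabilizable_KLE eta A B C (psi : 'I_eta -> 'cV[R]_n -> R) :
  is_KLE f h A B C psi ->
  lift_map psi x @[x --> (0 : 'cV[R]_n)] --> (0 : 'cV[R]_eta) ->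
  stabilizable f -> stabilizable (lin_dyn A B).
Proof.
move=> [/lin_indepP indep kle] psi0 f_stab.
apply: (lin_indep_span indep) => [|a v w|x0].
- exists (fun=> 0), (fun=> 0); split=> //; last apply: cvg_cst.
  by move=> t; rewrite /lin_dyn !mulmx0 addr0.
- move=> [u [x [xu x0 x_cvg]]] [u' [x' [xu' x0' x_cvg']]].
  exists (fun t => a *: u t + u' t), (fun t => a *: x t + x' t); split.
  + move=> t; rewrite xu xu' /lin_dyn !mulmxDr -!scalemxAr scalerDr.
    by rewrite addrACA.
  + by rewrite x0 x0'.
  + rewrite -[X in _ --> X]addr0 -{1}(scaler0 _ a).
    by apply: cvg_addmx => //; exact: cvg_scalemx.
- have [u [x [xu <- x_cvg]]] := f_stab x0.
  exists u, (fun t => lift_map psi (x t)); split=> //.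
  + by move=> t; have [-> _] := kle x u xu t.
  (* The neighbourhoods of 0 in [psi0] are not punctured, so the composition is valid even if [x t]
     reaches 0. *)
  + exact: (cvg_comp x _ x_cvg psi0).
Qed.

End KoopmanEmbedding.

Theorem proposition2 (R : realType) (n m p : nat)
  (f : 'cV[R]_n -> 'cV[R]_m -> 'cV[R]_n) (h : 'cV[R]_n -> 'cV[R]_p)
  (f_cont : continuous (fun z : 'cV[R]_n * 'cV[R]_m => f z.1 z.2))
  (h_cont : continuous h)
  (f00 : f 0 0 = 0) (h0 : h 0 = 0)
  (f_KLE : admits_KLE f h)
  (f_stab : stabilizable f) (f_det : detectable f h) :
  exists (eta : nat) (A : 'M[R]_eta) (B : 'M[R]_(eta, m))
    (C : 'M[R]_(p, eta)) (psi : 'I_eta -> 'cV[R]_n -> R),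
    [/\ is_KLE f h A B C psi,
        observable (lin_dyn A B) (lin_out C) &
        stabilizable (lin_dyn A B)].
Proof.
have [eta [A [B [C [psi [kle obsv psi0]]]]]] :=
  observable_KLE f_cont h_cont f00 h0 f_KLE.
exists eta, A, B, C, psi; split=> //.
exact: stabilizable_KLE kle psi0 f_stab.
Qed.
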